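(* Let $X,Y$ be Banach spaces, $P$ a metric space, $\Phi:X\times P\rightrightarrows Y$ and $\Psi:X\rightrightarrows Y$ multifunctions, and $(\overline{x},\overline{p},\overline{y})\in X\times P\times Y$ such that $((\overline{x},\overline{p}),\overline{y})\in\operatorname{Gr}\Phi$ and $(\overline{x},\overline{y})\in\operatorname{Gr}\Psi$. Denote $\Phi_p(\cdot):=\Phi(\cdot,p)$ and define $S:P\rightrightarrows X$ by $S(p):=\{x\in X\mid 0\in\Phi(x,p)-\Psi(x)\}=\{x\in X\mid\Phi(x,p)\cap\Psi(x)\neq\emptyset\}$. Suppose that: (i) $\operatorname{Gr}\Phi_p$ is locally closed around $(\overline{x},\overline{y})$ uniformly for $p$ in a neighborhood of $\overline{p}$; (ii) $\operatorname{Gr}\Psi$ is locally closed around $(\overline{x},\overline{y})$; (iii) $(\Phi,-\Psi)$ is locally sum-stable around $((\overline{x},\overline{p}),\overline{y},-\overline{y})$; (iv) $\Phi$ has the Aubin property with respect to $x$ uniformly in $p$ around $((\overline{x},\overline{p}),\overline{y})$ with constant $l>0$; (v) $\Psi$ is metrically regular with constant $m>0$ around $(\overline{x},\overline{y})$; (vi) $lm<1$. Then there exist $\alpha,\beta>0$ such that for every $(x,p)\in B(\overline{x},\alpha)\times B(\overline{p},\alpha)$, $$d(x,S(p))\leq(m^{-1}-l)^{-1}\,d\big(0,[\Phi(x,p)-\Psi(x)]\cap B(0,\beta)\big).$$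
   Context: $B(x,r)$, $D(x,r)$ are the open and closed balls; $\mathcal{V}(x)$ is the set of neighborhoods of $x$. $d(x,A)=\inf_{a\in A}d(x,a)$ with $d(x,\emptyset)=\infty$; the excess is $e(A,B)=\sup\{d(a,B)\mid a\in A\}$ (with $e(\emptyset,B)=0$). $\operatorname{Gr}T=\{(x,y)\mid y\in T(x)\}$, $T^{-1}(y)=\{x\mid y\in T(x)\}$, $(-\Psi)(x)=-\Psi(x)$, and sums/differences of sets are Minkowski sums/differences. Product spaces carry the additive metric. A set $A$ is locally closed around $a\in A$ if $A\cap D(a,r)$ is closed for some $r>0$. Assumption (i) means: there is $\gamma>0$ such that for every $p\in B(\overline{p},\gamma)$ the set $\operatorname{Gr}\Phi_p\cap[D(\overline{x},\gamma)\times D(\overline{y},\gamma)]$ is closed. $\Phi$ has the Aubin property with respect to $x$ uniformly in $p$ around $((\overline{x},\overline{p}),\overline{y})$ with constant $l$ if there exist $U\in\mathcal{V}(\overline{x})$, $V\in\mathcal{V}(\overline{p})$, $W\in\mathcal{V}(\overline{y})$ such that $e(\Phi_p(x)\cap W,\Phi_p(u))\leq l\,d(x,u)$ for all $x,u\in U$, $p\in V$. $\Psi$ is metrically regular with constant $m$ around $(\overline{x},\overline{y})$ if there exist $U\in\mathcal{V}(\overline{x})$, $V\in\mathcal{V}(\overline{y})$ such that $d(x,\Psi^{-1}(y))\leq m\,d(y,\Psi(x))$ for every $(x,y)\in U\times V$. For $F:X\times P\rightrightarrows Y$, $G:X\rightrightarrows Y$, $\overline{y}\in F(\overline{x},\overline{p})$,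 $\overline{z}\in G(\overline{x})$, the pair $(F,G)$ is locally sum-stable around $((\overline{x},\overline{p}),\overline{y},\overline{z})$ if for every $\varepsilon>0$ there exists $\delta>0$ such that, for every $(x,p)\in B(\overline{x},\delta)\times B(\overline{p},\delta)$ and every $w\in(F(x,p)+G(x))\cap B(\overline{y}+\overline{z},\delta)$, there exist $y\in F(x,p)\cap B(\overline{y},\varepsilon)$ and $z\in G(x)\cap B(\overline{z},\varepsilon)$ such that $w=y+z$. *)

(* Defs.v *)
From mathcomp Require Import all_boot all_order all_algebra.
From mathcomp Require Import all_classical all_reals all_analysis.
Set Implicit Arguments.
Unset Strict Implicit.
Unset Printing Implicit Defensive.
Import Order.TTheory GRing.Theory Num.Def Num.Theory.
Import numFieldNormedType.Exports.

Local Open Scope classical_set_scope.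
Local Open Scope ring_scope.

(* [edist_inf A x] is the distance d(x, A); it is [+oo] when [A] is empty, and
   by the following lemma it is the infimum of the norms [`|x - a|]. *)
Lemma edist_normE (R : realType) (V : normedModType R) (x y : V) :
  edist (x, y) = `|x - y|%:E.
Proof.
apply/eqP; rewrite eq_le; apply/andP; split; last first.
  apply: le_ereal_inf_tmp => _ [r [_ /=]] + <-.
  by rewrite -ball_normE /= lee_fin => /ltW.
apply/lee_addgt0Pr => e e0; rewrite -EFinD.
apply: edist_fin; first by rewrite ltr_wpDl.
by rewrite -ball_normE /= ltrDl.
Qed.

Lemma edist_infE (R : realType) (V : normedModType R) (A : set V) (x : V) :
  edist_inf A x = ereal_inf [set `|x - a|%:E | a in A].
Proof.
by rewrite /edist_inf; congr ereal_inf; apply: eq_imagel => a _; exact: edist_normE.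
Qed.

(* The case split is needed because [ereal_sup set0 = -oo]. *)
Definition excess (R : realType) (V : normedModType R) (A B : set V) : \bar R :=
  if A == set0 then 0%E else ereal_sup [set edist_inf B a | a in A].

Definition minkowski_sum (V : zmodType) (A B : set V) : set V :=
  [set a + b | a in A & b in B].

Definition minkowski_sub (V : zmodType) (A B : set V) : set V :=
  [set a - b | a in A & b in B].

Definition minkowski_opp (V : zmodType) (A : set V) : set V :=
  [set - a | a in A].

Definition mf_graph (T U : Type) (F : T -> set U) : set (T * U) :=
  [set z | F z.1 z.2].

Definition mf_inv (T U : Type) (F : T -> set U) : U -> set T :=
  fun y => [set x | F x y].

(* The norm of the library on a product is the maximum of the norms, which is
   why the closed ball of the additive metric is spelled out here. The topology
   (hence [closed]) is the same for both. *)
Definition sum_closed_ball (R : realType) (X Y : normedModType R)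
    (c : X * Y) (r : R) : set (X * Y) :=
  [set z | `|c.1 - z.1| + `|c.2 - z.2| <= r].

Definition locally_closed_around (R : realType) (X Y : normedModType R)
    (A : set (X * Y)) (a : X * Y) : Prop :=
  exists r : R, 0 < r /\ closed (A `&` sum_closed_ball a r).

Definition uniformly_locally_closed (R : realType) (X Y : normedModType R)
    (P : metricType R) (F : X * P -> set Y) (x0 : X) (p0 : P) (y0 : Y) : Prop :=
  exists g : R, 0 < g /\
    forall p : P, ball p0 g p ->
      closed (mf_graph (fun x => F (x, p)) `&`
              (closed_ball_ normr x0 g `*` closed_ball_ normr y0 g)).

Definition uniform_aubin (R : realType) (X Y : normedModType R)
    (P : metricType R) (F : X * P -> set Y) (x0 : X) (p0 : P) (y0 : Y)
    (l : R) : Prop :=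
  exists (U : set X) (V : set P) (W : set Y),
    [/\ nbhs x0 U, nbhs p0 V, nbhs y0 W &
      forall (x u : X) (p : P), U x -> U u -> V p ->
        (excess (F (x, p) `&` W) (F (u, p)) <= (l * `|x - u|)%:E)%E].

Definition metrically_regular (R : realType) (X Y : normedModType R)
    (F : X -> set Y) (x0 : X) (y0 : Y) (m : R) : Prop :=
  exists (U : set X) (V : set Y),
    [/\ nbhs x0 U, nbhs y0 V &
      forall (x : X) (y : Y), U x -> V y ->
        (edist_inf (mf_inv F y) x <= m%:E * edist_inf (F x) y)%E].

Definition locally_sum_stable (R : realType) (X Y : normedModType R)
    (P : metricType R) (F : X * P -> set Y) (G : X -> set Y)
    (x0 : X) (p0 : P) (y0 z0 : Y) : Prop :=
  forall e : R, 0 < e -> exists d : R, 0 < d /\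
    forall (x : X) (p : P) (w : Y), ball x0 d x -> ball p0 d p ->
      (minkowski_sum (F (x, p)) (G x) `&` ball (y0 + z0) d) w ->
      exists y z : Y, [/\ (F (x, p) `&` ball y0 e) y,
                          (G x `&` ball z0 e) z & w = y + z].

Definition solution_map (X P : Type) (Y : zmodType) (F : X * P -> set Y)
    (G : X -> set Y) : P -> set X :=
  fun p => [set x | minkowski_sub (F (x, p)) (G x) 0].

Lemma solution_mapE (X P : Type) (Y : zmodType) (F : X * P -> set Y)
    (G : X -> set Y) (p : P) :
  solution_map F G p = [set x | F (x, p) `&` G x !=set0].
Proof.
apply/seteqP; split=> x /=.
  by move=> [a Fa [b Gb /eqP]]; rewrite subr_eq0 => /eqP ab; exists a; split=> //; rewrite ab.
by move=> [y [Fy Gy]]; exists y => //; exists y => //; rewrite subrr.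
Qed.

(* Main.v *)
Require Import Defs.
From mathcomp Require Import all_boot all_order all_algebra.
From mathcomp Require Import all_classical all_reals all_analysis.
From mathcomp Require Import ring lra.
Import Order.TTheory GRing.Theory Num.Def Num.Theory.
Import numFieldNormedType.Exports.

Local Open Scope classical_set_scope.
Local Open Scope ring_scope.

(** Lyusternik-Graves iteration. From [y \in Phi_p x] and [z \in Psi x], metric
regularity gives [x'] near [x] with [y \in Psi x'], then the Aubin property
gives [y' \in Phi_p x'] near [y], and one restarts from [(x', y', y)]. The gap
[|y - z|] shrinks by a factor close to [l m < 1] at each step, so [x] and [y]
converge, and by closedness the limit [x] solves [Phi_p x `&` Psi x !=set0].
Summing the steps bounds the total displacement of [x] by about
[m / (1 - l m) * |y - z|]; the constant itself is reached by inflating [l] and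
[m] by a factor tending to [1], while the neighbourhoods stay fixed. *)

(** * Convergence, distances and the inflation factor *)

Lemma cvgn_geometric_steps (R : realType) (V : completeNormedModType R)
    (u : V ^nat) (C q : R) : 0 <= q < 1 ->
  (forall n, `|u n.+1 - u n| <= C * q ^+ n) -> cvgn u.
Proof.
move=> /andP[q0 q1] uq.
have sc : cvgn (series (telescope u)).
  apply: normed_cvg; apply: (@series_le_cvg _ _ (geometric C q)) => //=.
  - by move=> n; apply: le_trans (uq n).
  - by apply: is_cvg_geometric_series; rewrite ger0_norm.
have -> : u = cst (u 0%N) \+ series (telescope u).
  by apply/funext => n /=; rewrite [LHS]eq_sum_telescope.
by apply: is_cvgD => //; exact: is_cvg_cst.
Qed.

(** The infimum need not be attained, but the slack [k < k'] gives a point when [d > 0]. At [d = 0]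
    the slack vanishes, and [x] itself has to serve. *)
Lemma edist_inf_le_near (R : realType) (V : normedModType R) (A : set V) (x : V)
    (k k' d : R) : 0 <= d -> k < k' -> (d = 0 -> A x) ->
  (edist_inf A x <= (k * d)%:E)%E -> exists2 a, A a & `|x - a| <= k' * d.
Proof.
move=> d0 kk' Ax Ad.
have [d00|dn0] := eqVneq d 0.
  by exists x; [exact: Ax | rewrite subrr normr0 d00 mulr0].
have dgt0 : 0 < d by rewrite lt_neqAle eq_sym dn0.
have : (edist_inf A x < (k' * d)%:E)%E.
  by apply: le_lt_trans Ad _; rewrite lte_fin ltr_pM2r.
rewrite edist_infE => /ereal_inf_lt[_ [a Aa <-]]; rewrite lte_fin => /ltW xa.
by exists a.
Qed.

Lemma edist_inf_le_norm (R : realType) (V : normedModType R) (A : set V)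
    (x a : V) : A a -> (edist_inf A x <= `|x - a|%:E)%E.
Proof. by move=> Aa; rewrite edist_infE; apply: ereal_inf_lbound; exists a. Qed.

Lemma edist_inf_le_excess (R : realType) (V : normedModType R) (A B : set V)
    (a : V) : A a -> (edist_inf B a <= excess A B)%E.
Proof.
move=> Aa; rewrite /excess; case: eqP => [A0|_]; first by move: Aa; rewrite A0.
by apply: ereal_sup_ubound; exists a.
Qed.

Lemma exists_inflation (R : realType) (a b t : R) :
  0 <= a -> 0 <= b -> a + b < t ->
  exists2 s, 1 < s & s * a < t - s ^+ 2 * b.
Proof.
move=> a0 b0 abt.
have t0 : 0 < t + (a + b) by lra.
(* This [s] gives [s ^+ 2 * (a + b) = t - t * (s - 1) ^+ 2 < t], and [s * a <= s ^+ 2 * a]. *)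
pose s := 2 * t / (t + (a + b)).
have s1 : 1 < s by rewrite /s ltr_pdivlMr //; lra.
have st : s * (t + (a + b)) = 2 * t by rewrite /s mulfVK // gt_eqF.
exists s => //; move: s1 st; clearbody s => s1 st.
have h2 : s * (a + b) = 2 * t - s * t by lra.
have h3 : s ^+ 2 * (a + b) = s * (2 * t - s * t) by rewrite -h2; ring.
have h4 : 0 < t * (s - 1) ^+ 2 by rewrite mulr_gt0 ?exprn_gt0 //; lra.
have h5 : s * a <= s ^+ 2 * a by rewrite expr2 -mulrA ler_peMl // ?mulr_ge0 //; lra.
lra.
Qed.

(** * The iteration for two abstract graphs *)

Section LyusternikGraves.
Context {R : realType} {X Y : completeNormedModType R}.
(** [A] and [B] stand for the graphs of [Phi_p] and [Psi], [K] and [L] for boxes on which they are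
    closed. The iteration starts at [x0], and [small] bounds the sum of all its geometric steps by
    [t]. *)
Variables (A B K L : set (X * Y)) (x0 : X) (y0 z0 : Y) (mu lam t : R).
Hypotheses (mu0 : 0 < mu) (lam0 : 0 < lam) (lm1 : lam * mu < 1).
Hypotheses (A0 : A (x0, y0)) (B0 : B (x0, z0)).
Hypothesis small : mu * `|y0 - z0| <= (1 - lam * mu) * t.
Hypothesis A_step : forall x u y, `|x - x0| <= t -> `|u - x0| <= t ->
  `|y - y0| <= lam * t -> A (x, y) ->
  exists2 v, A (u, v) & `|y - v| <= lam * `|x - u|.
Hypothesis B_step : forall x y z, `|x - x0| <= t -> `|y - y0| <= lam * t ->
  B (x, z) -> exists2 u, B (u, y) & `|x - u| <= mu * `|y - z|.
Hypotheses (Acl : closed (A `&` K)) (Bcl : closed (B `&` L)).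
Hypothesis box : forall x y, `|x - x0| <= t -> `|y - y0| <= lam * t ->
  K (x, y) /\ L (x, y).

Let state := (X * Y * Y)%type.

(* The displacement made so far plus the displacement [mu * gap / (1 - lam mu)]
   still to come stays within [t]; likewise for [y], scaled by [lam]. *)
Let inv (s : state) :=
  let: (x, y, z) := s in
  [/\ A (x, y), B (x, z),
      mu * `|y - z| + (1 - lam * mu) * `|x - x0| <= (1 - lam * mu) * t &
      lam * mu * `|y - z| + (1 - lam * mu) * `|y - y0|
        <= (1 - lam * mu) * (lam * t)].

(** Since [z' = y], the new gap is [|y' - y|], at most [lam * mu] times the old one. *)
Let step (s s' : state) :=
  let: (x, y, z) := s in let: (x', y', z') := s' in
  [/\ z' = y, `|x - x'| <= mu * `|y - z| & `|y - y'| <= lam * `|x - x'|].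

Let inv_bound (s : state) : inv s ->
  `|s.1.1 - x0| <= t /\ `|s.1.2 - y0| <= lam * t.
Proof.
have q1 : 0 < 1 - lam * mu by rewrite subr_gt0.
have lm0 : 0 < lam * mu by rewrite mulr_gt0.
case: s => [[x y] z] /= [_ _ hx hy]; split; rewrite -(ler_pM2l q1).
- by apply: le_trans hx; rewrite lerDr mulr_ge0 // ltW.
- by apply: le_trans hy; rewrite lerDr mulr_ge0 // ltW.
Qed.

(** The invariant sits under the existential so that [choice] yields a total map on states; where it
    fails, any state serves. *)
Let inv_step (s : state) : exists s', inv s -> inv s' /\ step s s'.
Proof.
have [sinv|] := pselect (inv s); last by exists s.
case: s sinv => [[x y] z] sinv; have := inv_bound _ sinv => /= -[hx hy].
have q1 : 0 < 1 - lam * mu by rewrite subr_gt0.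
case: (sinv) => /= Axy Bxz ix iy.
have [u Bu xu] := B_step _ _ _ hx hy Bxz.
have xux : `|u - x0| <= `|x - x0| + `|x - u|.
  by rewrite [leRHS]addrC (distrC x u); exact: ler_distD.
have key : (1 - lam * mu) * `|u - x0| <=
    (1 - lam * mu) * (`|x - x0| + `|x - u|) by rewrite ler_pM2l.
(* [A_step] needs [u] in the ball as well; the gap term of the invariant pays for the move from [x]
   to [u]. *)
have hu : `|u - x0| <= t.
  rewrite -(ler_pM2l q1); apply: le_trans key _; apply: le_trans ix.
  rewrite mulrDr [leLHS]addrC lerD2r; apply: le_trans xu.
  by rewrite ler_piMl // lerBlDr lerDl ltW // mulr_gt0.
have [v Av yv] := A_step _ u _ hx hu hy Axy.
exists (u, v, y) => _; split; last by split.
split => //.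
- have h1 : mu * `|v - y| <= mu * (lam * `|x - u|).
    by rewrite ler_pM2l // distrC.
  lra.
- have yvy : `|v - y0| <= `|y - y0| + `|v - y|.
    by rewrite [leRHS]addrC; exact: ler_distD.
  have h1 : (1 - lam * mu) * `|v - y0| <=
    (1 - lam * mu) * (`|y - y0| + `|v - y|) by rewrite ler_pM2l.
  have h2 : lam * `|x - u| <= lam * (mu * `|y - z|) by rewrite ler_pM2l.
  rewrite (distrC y v) in yv; lra.
Qed.

Lemma exists_common_point : exists x y,
  [/\ A (x, y), B (x, y) & `|x - x0| <= t].
Proof.
have [f fP] := choice inv_step.
pose s n : state := iter n f (x0, y0, z0).
have sinv n : inv (s n).
  elim: n => [|n IHn]; last by case: (fP _ IHn).
  (* Before any move, both bounds of [inv] reduce to [small], the second after cancelling [lam]. *)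
  split=> //=; rewrite subrr normr0 mulr0 addr0 // -mulrA.
  by rewrite (mulrCA _ lam) ler_pM2l.
have sstep n : step (s n) (s n.+1) by case: (fP _ (sinv n)).
pose x n := (s n).1.1; pose y n := (s n).1.2; pose z n := (s n).2.
have As n : A (x n, y n).
  by have := sinv n; rewrite /x /y; case: (s n) => [[? ?] ?] [].
have Bs n : B (x n, z n).
  by have := sinv n; rewrite /x /z; case: (s n) => [[? ?] ?] [].
have [xt yt] : (forall n, `|x n - x0| <= t) /\ (forall n, `|y n - y0| <= lam * t).
  by split=> n; have [] := inv_bound _ (sinv n).
have sE n : [/\ z n.+1 = y n, `|x n - x n.+1| <= mu * `|y n - z n| &
    `|y n - y n.+1| <= lam * `|x n - x n.+1|].
  have := sstep n; rewrite /x /y /z.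
  by case: (s n) => [[? ?] ?]; case: (s n.+1) => [[? ?] ?].
have gap n : `|y n - z n| <= `|y0 - z0| * (lam * mu) ^+ n.
  elim: n => [|n IHn]; first by rewrite expr0 mulr1.
  have [-> hx hy] := sE n; rewrite distrC; apply: le_trans hy _.
  rewrite exprS mulrCA -(mulrA lam) ler_pM2l //; apply: le_trans hx _.
  by rewrite ler_pM2l.
have xC n : `|x n.+1 - x n| <= mu * `|y0 - z0| * (lam * mu) ^+ n.
  have [_ hx _] := sE n; rewrite distrC; apply: le_trans hx _.
  by rewrite -mulrA ler_pM2l.
have yC n : `|y n.+1 - y n| <= lam * (mu * `|y0 - z0|) * (lam * mu) ^+ n.
  have [_ hx hy] := sE n; rewrite distrC; apply: le_trans hy _.
  by rewrite -mulrA ler_pM2l // distrC.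
have q01 : 0 <= lam * mu < 1 by rewrite lm1 mulr_ge0 // ltW.
have cx := cvgn_geometric_steps _ _ _ _ _ q01 xC.
have cy := cvgn_geometric_steps _ _ _ _ _ q01 yC.
(* The points of [B] are [(x n.+1, z n.+1) = (x n.+1, y n)], hence the shift. *)
have cx' : x n.+1 @[n --> \oo] --> limn x by rewrite cvg_shiftS.
exists (limn x), (limn y); split.
- have [] // : (A `&` K) (limn x, limn y).
  apply: (@closed_cvg _ _ \oo _ (fun n => (x n, y n)) _ Acl);
    last exact: cvg_pair cx cy.
  by near=> n; split; [exact: As | exact: (box _ _ (xt n) (yt n)).1].
- have [] // : (B `&` L) (limn x, limn y).
  apply: (@closed_cvg _ _ \oo _ (fun n => (x n.+1, y n)) _ Bcl);
    last exact: cvg_pair cx' cy.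
  near=> n; split; last exact: (box _ _ (xt n.+1) (yt n)).2.
  by have [<- _ _] := sE n; exact: Bs.
- apply: (@closed_cvg _ _ \oo _ x [set u | `|u - x0| <= t]) => //.
  + have -> : [set u : X | `|u - x0| <= t] = closed_ball_ normr x0 t.
      by apply/seteqP; split=> u; rewrite /closed_ball_ /= distrC.
    exact: closed_closed_ball_.
  + by near=> n; exact: xt.
Unshelve. all: by end_near. Qed.

End LyusternikGraves.

(** * Choice of radii and application to [Phi] and [Psi] *)

Lemma nbhs_normball (R : realType) (V : normedModType R) (x : V) (U : set V) :
  nbhs x U -> exists2 r, 0 < r & forall u, `|u - x| < r -> U u.
Proof.
move=> /nbhs_ballP[r /= r0 rU]; exists r => // u ux.
by apply: rU; rewrite -ball_normE /ball_ /= distrC.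
Qed.

Theorem theorem3p15 (R : realType) (X Y : completeNormedModType R)
    (P : metricType R) (Phi : X * P -> set Y) (Psi : X -> set Y)
    (xbar : X) (pbar : P) (ybar : Y) (l m : R)
    (hPhi : mf_graph Phi ((xbar, pbar), ybar))
    (hPsi : mf_graph Psi (xbar, ybar))
    (hi : uniformly_locally_closed Phi xbar pbar ybar)
    (hii : locally_closed_around (mf_graph Psi) (xbar, ybar))
    (hiii : locally_sum_stable Phi (fun x => minkowski_opp (Psi x))
              xbar pbar ybar (- ybar))
    (hl : 0 < l) (hiv : uniform_aubin Phi xbar pbar ybar l)
    (hm : 0 < m) (hv : metrically_regular Psi xbar ybar m)
    (hvi : l * m < 1) :
  exists a b : R, [/\ 0 < a, 0 < b &
    forall (x : X) (p : P), ball xbar a x -> ball pbar a p ->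
      (edist_inf (solution_map Phi Psi p) x <=
        ((m^-1 - l)^-1)%:E *
        edist_inf (minkowski_sub (Phi (x, p)) (Psi x) `&` ball 0%R b) 0%R)%E].
Proof.
case: hi => g [g0 gcl]; case: hii => r [r0 rcl].
case: hiv => U [V [W [/nbhs_normball[u0 u00 uU] /nbhs_ballP[v0 /= v00 vV]
  /nbhs_normball[w0 w00 wW] aub]]].
case: hv => U' [V' [/nbhs_normball[u1 u10 uU'] /nbhs_normball[v1 v10 vV'] mr]].

(* Iterates will stay within [d] of [xbar] and [2 * d] of [ybar]; halving [r] makes these two
   distances sum to less than [r]. *)
pose d := minr (minr (minr g (r / 2)) (minr u0 w0)) (minr u1 v1) / 2.
have d0 : 0 < d by rewrite divr_gt0 // !lt_min !divr_gt0 // g0 u00 w00 u10 v10.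
have : 2 * d <= minr (minr (minr g (r / 2)) (minr u0 w0)) (minr u1 v1).
  by rewrite mulrC divfK.
rewrite !le_min => /andP[/andP[/andP[dg dr] /andP[du dw]] /andP[du1 dv1]].
clearbody d.
have [e [e0 stab]] := hiii d d0.
(* With [t <= tau], the drift of [x] is at most [d / 2], and so is that of [y], because the product
   of the inflated constants stays below 1. *)
pose tau := minr (d / 2) (m * (d / 2)).
have d20 : 0 < d / 2 by rewrite divr_gt0.
have tau0 : 0 < tau by rewrite lt_min d20 mulr_gt0.
have c0 : 0 < (m^-1 - l)^-1.
  by rewrite invr_gt0 subr_gt0 -[m^-1]div1r ltr_pdivlMr.
have cm : (m^-1 - l)^-1 * (1 - l * m) = m.
  have -> : 1 - l * m = m * (m^-1 - l) by field; rewrite gt_eqF.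
  by rewrite mulrCA mulVf ?mulr1 // -invr_eq0 gt_eqF.
set c := (m^-1 - l)^-1 in c0 cm *; clearbody c.
(* The bound [tau / c] ensures that the displacement [c * |w|] fits below [tau]. *)
exists (minr (minr e (d / 2)) (minr v0 g)), (minr e (tau / c)); split.
- by rewrite !lt_min e0 v00 g0 divr_gt0.
- by rewrite lt_min e0 divr_gt0.
move=> x p xa pa.
have xe : ball xbar e x by apply: le_ball xa; rewrite !ge_min lexx.
have pe : ball pbar e p by apply: le_ball pa; rewrite !ge_min lexx.
have pg : ball pbar g p by apply: le_ball pa; rewrite !ge_min lexx !orbT.
have Vp : V p by apply: vV; apply: le_ball pa; rewrite !ge_min lexx !orbT.
have xd : `|x - xbar| < d / 2.
  rewrite distrC; move: xa; rewrite -ball_normE /ball_ /= => /lt_le_trans; apply.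
  by rewrite !ge_min lexx orbT.
rewrite [X in (_ <= _ * X)%E]edist_infE -ereal_inf_pZl //.
apply: le_ereal_inf_tmp => _ [_ [w [[y Fy [z Gz yzw]] wb] <-] <-].
have {wb}[we wt] : `|w| < e /\ c * `|w| < tau.
  move: wb; rewrite -ball_normE /ball_ /= sub0r normrN lt_min => /andP[-> wc].
  by rewrite mulrC -ltr_pdivlMr.
(* The given [y] and [z] may be far from [ybar]; sum-stability rewrites [w] as a difference of
   nearby points. *)
have [] := stab x p w xe pe.
  split; first by exists y => //; exists (- z) => //; exists z.
  by rewrite subrr -ball_normE /ball_ /= sub0r normrN.
move=> y1 [_ [[Fy1 y1d] [[z1 Gz1 <-] _] wE]]; rewrite wE sub0r normrN.
rewrite {}wE in wt; clear y z w Fy Gz yzw we.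
have {}y1d : `|y1 - ybar| < d.
  by rewrite distrC; move: y1d; rewrite -ball_normE.
rewrite -EFinM; apply/lee_addgt0Pr => eps eps0; rewrite -EFinD.
pose t := minr tau (c * `|y1 - z1| + eps).
have t0 : c * `|y1 - z1| < t by rewrite lt_min wt ltrDl eps0.
have tt : t <= tau by rewrite ge_min lexx.
suff [x1 Sx1 x1t] : exists2 x1, solution_map Phi Psi p x1 & `|x1 - x| <= t.
  apply: le_trans (edist_inf_le_norm _ _ _ _ _ Sx1) _.
  rewrite lee_fin distrC; apply: le_trans x1t _.
  by rewrite ge_min lexx orbT.
have [td tmd] : t <= d / 2 /\ t <= m * (d / 2).
  by move: tt; rewrite le_min => /andP[].
clearbody t; clear tt.
have lm1 : 0 < 1 - l * m by rewrite subr_gt0.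
(* As [c * (1 - l * m) = m], the strict excess of [t] over [c * |y1 - z1|] leaves room to inflate
   [l] and [m] by [s]. *)
have mt : m * `|y1 - z1| + l * m * t < t.
  have : (1 - l * m) * (c * `|y1 - z1|) < (1 - l * m) * t by rewrite ltr_pM2l.
  by rewrite mulrA [_ * c]mulrC cm; lra.
have t_ge0 : 0 < t by apply: le_lt_trans t0; rewrite mulr_ge0 // ltW.
have [||s s1 st] := exists_inflation _ _ _ _ _ _ mt.
- by rewrite mulr_ge0 // ltW.
- by rewrite !mulr_ge0 // ltW.
have s0 : 0 < s by lra.
(* Dropping the nonnegative gap term from [st] and dividing by [t] gives the contraction. *)
have lms : (l * s) * (m * s) < 1.
  rewrite -(ltr_pM2r t_ge0).
  have : 0 <= s * (m * `|y1 - z1|) by rewrite !mulr_ge0 // ltW.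
  lra.
have lt_d : l * s * t <= d / 2.
  apply: (@le_trans _ _ (l * s * (m * s * (d / 2)))).
    rewrite ler_pM2l ?mulr_gt0 //; apply: le_trans tmd _.
    by rewrite ler_pM2r ?divr_gt0 // ler_peMr // ltW.
  by rewrite mulrA ler_piMl ?ltW // divr_gt0.
have near_x u : `|u - x| <= t -> `|u - xbar| <= d.
  by have := ler_distD x u xbar; lra.
have near_y v : `|v - y1| <= l * s * t -> `|v - ybar| < 2 * d.
  by have := ler_distD y1 v ybar; lra.
have [x2 [y2 [Fx2 Gx2 x2t]]] : exists x1 y,
  [/\ mf_graph (fun u => Phi (u, p)) (x1, y), mf_graph Psi (x1, y) &
      `|x1 - x| <= t].
  apply: (exists_common_point (mf_graph (fun u => Phi (u, p))) (mf_graph Psi)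
    (closed_ball_ normr xbar g `*` closed_ball_ normr ybar g)
    (sum_closed_ball (xbar, ybar) r) x y1 z1 (m * s) (l * s) t) => //.
  - by rewrite mulr_gt0.
  - by rewrite mulr_gt0.
  - lra.
  - move=> u u' v ut u't vt Fuv.
    apply: (edist_inf_le_near _ _ _ _ l) => //; first by rewrite ltr_pMr.
      by move=> /normr0_eq0/subr0_eq <-.
    apply: le_trans (aub u u' p _ _ Vp).
    + by apply: edist_inf_le_excess; split => //; apply: wW; have := near_y v vt; lra.
    + by apply: uU; have := near_x u ut; lra.
    + by apply: uU; have := near_x u' u't; lra.
  - move=> u v v' ut vt Guv.
    apply: (edist_inf_le_near _ _ (mf_inv Psi v) _ m) => //; first by rewrite ltr_pMr.
      by move=> /normr0_eq0/subr0_eq ->.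
    apply: le_trans (mr u v _ _) _.
    + by apply: uU'; have := near_x u ut; lra.
    + by apply: vV'; have := near_y v vt; lra.
    + by rewrite EFinM lee_pmul2l ?lte_fin //; exact: edist_inf_le_norm.
  - exact: gcl.
  - move=> u v ut vt; have := near_x u ut; have := near_y v vt => v2 u2.
    split; [split|]; rewrite /closed_ball_ /sum_closed_ball /=
      ?(distrC xbar) ?(distrC ybar); lra.
by exists x2 => //; rewrite solution_mapE; exists y2.
Qed.
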